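(* Let $n\ge 1$ be an integer and let $K=\{123,132\}\{213,231\}$. The number of equivalence classes of $S_n$ under $K$-equivalence is $2^{n-1}$.
   Context: Permutations in $S_n$ are written as words $\pi_1\pi_2\cdots\pi_n$ in one-line notation. The order permutation of a word $u$ of $c$ distinct positive integers is the unique $\sigma\in S_c$ with $\sigma_i<\sigma_j$ iff $u_i<u_j$. A replacement partition $K$ of $S_c$ is a set partition of $S_c$; it is denoted by listing its parts with the one-element parts (and outer brackets) omitted, so here $K$ is the set partition of $S_3$ whose only parts of size greater than one are $\{123,132\}$ and $\{213,231\}$. The $K$-equivalence on $S_n$ is the equivalence relation generated by: $\phi\equiv\psi$ whenever $\phi=aub$ and $\psi=avb$ (concatenations) for some possibly empty words $a,b$ and words $u,v$ of length $c$ (so $u,v$ occupy the same $c$ consecutive positions) such that the order permutations of $u$ and $v$ lie in the same part of $K$. All equivalence classes are counted, including one-element classes. *)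

(* Defs.v *)
From Stdlib Require Import Relation_Operators.
From mathcomp Require Import all_boot all_fingroup.
From mathcomp Require Import boolp.

Set Implicit Arguments.
Unset Strict Implicit.
Unset Printing Implicit Defensive.

(* The elements of 'I_n start at 0; the letters of a word start at 1. *)
Definition one_line (n : nat) (s : 'S_n) : seq nat :=
  [seq (val (s i)).+1 | i <- enum 'I_n].

(* When u consists of c distinct letters, exactly one s satisfies this. *)
Definition is_order_perm (c : nat) (u : seq nat) (s : 'S_c) : Prop :=
  size u = c /\
  forall i j : 'I_c, (s i < s j) = (nth 0 u i < nth 0 u j).

Definition perms_of_words (c : nat) (ws : seq (seq nat)) : {set 'S_c} :=
  [set s | one_line s \in ws].

(* The set partition of S_c denoted by a list of parts from which the
   one-element parts have been omitted. *)
Definition with_singletons (c : nat) (P : {set {set 'S_c}}) :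
    {set {set 'S_c}} :=
  P :|: [set [set s] | s in ~: cover P].

Definition replacement_step (c : nat) (K : {set {set 'S_c}}) (n : nat)
    (phi psi : 'S_n) : Prop :=
  exists a b u v : seq nat,
    [/\ one_line phi = a ++ u ++ b,
        one_line psi = a ++ v ++ b
      & exists s t : 'S_c,
          [/\ is_order_perm u s, is_order_perm v t
            & exists2 B : {set 'S_c}, B \in K & (s \in B) && (t \in B)]].

Definition replacement_equiv (c : nat) (K : {set {set 'S_c}}) (n : nat) :
    'S_n -> 'S_n -> Prop :=
  clos_refl_sym_trans 'S_n (@replacement_step c K n).

Definition replacement_classes (c : nat) (K : {set {set 'S_c}}) (n : nat) :
    {set {set 'S_n}} :=
  [set [set psi | `[< replacement_equiv K phi psi >]] | phi : 'S_n].

Definition K_123_132_213_231 : {set {set 'S_3}} :=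
  with_singletons
    [set perms_of_words 3 [:: [:: 1; 2; 3]; [:: 1; 3; 2]];
         perms_of_words 3 [:: [:: 2; 1; 3]; [:: 2; 3; 1]]].

Lemma with_singletons_partition (c : nat) (P : {set {set 'S_c}}) :
  trivIset P -> set0 \notin P -> partition (with_singletons P) [set: 'S_c].
Proof.
move=> /trivIsetP tP P0; apply/and3P; split.
- rewrite eqEsubset subsetT /=; apply/subsetP => s _; apply/bigcupP.
  have [/bigcupP[B BP sB]|sP] := boolP (s \in cover P).
    by exists B; rewrite // inE BP.
  exists [set s]; last by rewrite inE.
  by rewrite inE; apply/orP; right; apply: imset_f; rewrite inE.
- have sing s B : s \in ~: cover P -> B \in P -> [disjoint B & [set s]].
    rewrite inE => /bigcupP sP BP; rewrite disjoint_sym disjoints1.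
    by apply/negP => sB; apply: sP; exists B.
  apply/trivIsetP => A B; rewrite !inE.
  case/orP=> [AP|/imsetP[s sP ->]]; case/orP=> [BP|/imsetP[t tP' ->]] neq.
  + exact: tP.
  + exact: sing.
  + by rewrite disjoint_sym; apply: sing.
  + by rewrite disjoints1 inE; apply: contraNneq neq => ->.
- rewrite inE negb_or P0 /=; apply/imsetP => -[s _ /setP/(_ s)].
  by rewrite !inE eqxx.
Qed.

Lemma partition_K_123_132_213_231 : partition K_123_132_213_231 [set: 'S_3].
Proof.
pose o (k : nat) : 'I_3 := inord k.
have wE (s : 'S_3) :
    one_line s = [:: (val (s (o 0))).+1; (val (s (o 1))).+1; (val (s (o 2))).+1].
  rewrite /one_line.
  have -> : enum 'I_3 = [:: o 0; o 1; o 2].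
    by apply: (inj_map val_inj); rewrite val_enum_ord /= !inordK.
  by [].
apply: with_singletons_partition.
- apply/trivIsetP => A B; rewrite !inE.
  case/orP=> /eqP ->; case/orP=> /eqP ->; rewrite ?eqxx // => _;
  rewrite -setI_eq0; apply/eqP/setP => s; rewrite !inE; apply/negP;
  by case/andP=> /orP[]/eqP ->.
- rewrite !inE negb_or; apply/andP; split.
    apply/eqP => /setP/(_ 1%g); rewrite !inE wE !permE /= !inordK //.
  apply/eqP => /setP/(_ (tperm (o 0) (o 1))).
  have o2 k : k < 2 -> o k != o 2.
    by move=> k2; rewrite -val_eqE /= !inordK ?ltn_eqF // ltnW.
  by rewrite !inE wE tpermL tpermR tpermD ?o2 //= !inordK.
Qed.

(* Main.v *)
Require Import Defs.
From mathcomp Require Import all_boot all_fingroup.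
From Stdlib Require Import Relation_Operators.
From mathcomp Require Import boolp zify.

Set Implicit Arguments.
Unset Strict Implicit.
Unset Printing Implicit Defensive.

(** In a triple a b c, the parts 123, 132 and 213, 231 allow the exchange of
    the last two letters exactly when a is not the largest of the three.  Such
    an exchange preserves the left-to-right minima of the word: the larger of b
    and c is not a minimum, since a precedes it, and it has no influence on
    whether a smaller letter is one.

    Conversely, two permutations with the same left-to-right minima are
    equivalent, by induction on n ([word_equiv_lrmin]).  If n is the first
    letter of a word it is a left-to-right minimum, and the remaining letters
    may be rewritten without touching it.  Otherwise n is not a left-to-right
    minimum and can be moved past any letter on its right, hence to the end of
    the word, where it plays no part in rewriting the others.  The equal minima
    put both permutations in the same one of these two cases.

    Classes therefore correspond to the possible sets of left-to-right minima.
    Such a set contains 1, and every subset of 2, ..., n occurs as the rest of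
    it ([lrmin_set_onto]): insert the letters in increasing order, each one in
    front if it has to be a minimum and at the end otherwise. *)

(** * Left-to-right minima *)

(** The letters of a word that are smaller than all the letters before them, in
    order of occurrence. *)
Fixpoint lrmin (w : seq nat) : seq nat :=
  if w is x :: w' then x :: [seq y <- lrmin w' | y < x] else [::].

Lemma lrmin_cat p q :
  lrmin (p ++ q) = lrmin p ++ [seq y <- lrmin q | all (fun x => y < x) p].
Proof.
elim: p => [|x p IH] /=; first by rewrite filter_predT.
by rewrite IH filter_cat -filter_predI.
Qed.

Lemma lrmin_subset w : {subset lrmin w <= w}.
Proof.
elim: w => [//|x w IH] y /=; rewrite !inE mem_filter.
by case/orP=> [->//|/andP[_ /IH ->]]; rewrite orbT.
Qed.

Lemma lrmin_sorted w : sorted gtn (lrmin w).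
Proof.
have gtr : transitive gtn by move=> y x z /=; lia.
elim: w => [//|x w IH] /=.
by rewrite path_sortedE // filter_all sorted_filter.
Qed.

Lemma mem_lrmin_min w x : x \in w -> all (leq x) w -> x \in lrmin w.
Proof.
elim: w => [//|y w IH] /=; rewrite !inE mem_filter.
have [->//|neq] := eqVneq x y; move=> /= xw /andP[xy /IH -> //].
by rewrite andbT ltn_neqAle neq.
Qed.

(** A letter larger than all the others is a left-to-right minimum only in
    first position, and does not affect the minimality of the others. *)
Lemma lrmin_max p q m : all (ltn^~ m) (p ++ q) ->
  lrmin (p ++ m :: q) = if p is [::] then m :: lrmin q else lrmin (p ++ q).
Proof.
rewrite all_cat => /andP[pm qm].
have Em : [seq y <- lrmin q | y < m] = lrmin q.
  by apply/all_filterP/allP => y /lrmin_subset/(allP qm).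
case: p pm => [_|x p pm] /=; first by rewrite Em.
congr cons; rewrite !lrmin_cat !filter_cat /= Em; congr cat.
by case: ifP => //= _; case/andP: pm => xm _; rewrite ltnNge (ltnW xm).
Qed.

(** * Exchanging letters in words *)

(** The exchange of the last two letters of three consecutive ones, the first of
    which is not the largest. *)
Definition word_step (w w' : seq nat) : Prop :=
  exists p q a b c,
    [/\ w = p ++ [:: a; b; c] ++ q, w' = p ++ [:: a; c; b] ++ q
      & a < maxn b c].

(** As [word_step] is symmetric, its reflexive transitive closure is an
    equivalence. *)
Definition word_equiv := clos_refl_trans _ word_step.

Lemma word_step_sym w w' : word_step w w' -> word_step w' w.
Proof.
by move=> [p [q [a [b [c [-> -> h]]]]]]; exists p, q, a, c, b; rewrite maxnC.
Qed.

Lemma word_equiv_sym w w' : word_equiv w w' -> word_equiv w' w.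
Proof.
elim=> [x y /word_step_sym|x|x y z _ h1 _ h2]; first exact: rt_step.
  exact: rt_refl.
exact: rt_trans h2 h1.
Qed.

Lemma word_equiv_cat p q w w' :
  word_equiv w w' -> word_equiv (p ++ w ++ q) (p ++ w' ++ q).
Proof.
elim=> [x y [p1 [q1 [a [b [c [-> -> h]]]]]]|x|x y z _ h1 _ h2].
- apply: rt_step; exists (p ++ p1), (q1 ++ q), a, b, c.
  by rewrite -!catA.
- exact: rt_refl.
- exact: rt_trans h1 h2.
Qed.

Lemma word_step_perm w w' : word_step w w' -> perm_eq w w'.
Proof.
move=> [p [q [a [b [c [-> -> _]]]]]]; rewrite perm_cat2l perm_cat2r.
by rewrite perm_cons (perm_catC [:: b] [:: c]).
Qed.

Lemma word_step_lrmin w w' : word_step w w' -> lrmin w = lrmin w'.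
Proof.
move=> [p [q [a [b [c [-> -> h]]]]]].
rewrite lrmin_cat [RHS]lrmin_cat; congr (_ ++ filter _ _).
rewrite !lrmin_cat; congr (_ ++ _); last first.
  by apply: eq_filter => y /=; rewrite !andbT [(y < c) && _]andbC.
rewrite /=; congr cons.
case: (ltngtP b c) h => [bc|cb|->//] /ltnW; rewrite leqNgt => /negPf h.
  by rewrite /= h; case: ifP.
by rewrite /= h; case: ifP => //= _; rewrite h.
Qed.

(** The letter a in front of m is needed: the first letter of a word can never
    be moved. *)
Lemma word_equiv_max_last p q a m : all (ltn^~ m) (a :: q) ->
  word_equiv (p ++ a :: m :: q) (p ++ a :: q ++ [:: m]).
Proof.
elim: q p a => [|c q IH] p a; first by move=> _; apply: rt_refl.
move=> /andP[/= am cqm].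
apply: (rt_trans _ _ _ (p ++ a :: c :: m :: q)).
  by apply: rt_step; exists p, q, a, m, c; split=> //; rewrite leq_max am.
by have := IH (rcons p a) c cqm; rewrite -!cats1 -!catA.
Qed.

Lemma iota1_rcons n : iota 1 n.+1 = rcons (iota 1 n) n.+1.
Proof. by have := iotaD 1 n 1; rewrite addn1 add1n cats1. Qed.

Lemma iota_max_split n w : perm_eq w (iota 1 n.+1) ->
  exists p q, [/\ w = p ++ n.+1 :: q, perm_eq (p ++ q) (iota 1 n)
                & all (ltn^~ n.+1) (p ++ q)].
Proof.
move=> wi; have mw : n.+1 \in w by rewrite (perm_mem wi) mem_iota; lia.
case/splitPr: mw wi => p q wi; exists p, q.
have pqi : perm_eq (p ++ q) (iota 1 n).
  rewrite -(perm_cons n.+1); apply: perm_trans (_ : perm_eq (p ++ n.+1 :: q) _).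
    by rewrite -cat1s perm_catCA.
  by rewrite (perm_trans wi) // iota1_rcons perm_rcons.
split=> //; apply/allP => x.
by rewrite (perm_mem pqi) mem_iota => /andP[].
Qed.

Lemma word_equiv_lrmin n w w' :
  perm_eq w (iota 1 n) -> perm_eq w' (iota 1 n) -> lrmin w = lrmin w' ->
  word_equiv w w'.
Proof.
elim: n w w' => [|n IH] w w'.
  by move=> /perm_nilP -> /perm_nilP -> _; apply: rt_refl.
move=> /iota_max_split[p [q [-> pq mpq]]] /iota_max_split[p' [q' [-> pq' mpq']]].
rewrite !lrmin_max //.
(* In the mixed cases the equal minima would start with n + 1 in one word, and
   with a smaller letter in the other. *)
case: p p' pq pq' mpq mpq' => [|a p] [|a' p'] pq pq' mpq mpq' E.
- case: E => /(IH _ _ pq pq') /(word_equiv_cat [:: n.+1] [::]).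
  by rewrite !cats0.
- by case: E mpq' => <- /=; rewrite ltnn.
- by case: E mpq => -> /=; rewrite ltnn.
(* A largest letter that is not in front moves to the end of the word. *)
have to_end b r s : all (ltn^~ n.+1) ((b :: r) ++ s) ->
    word_equiv ((b :: r) ++ n.+1 :: s) ([::] ++ ((b :: r) ++ s) ++ [:: n.+1]).
  move=> brs; have := @word_equiv_max_last (belast b r) s (last b r) n.+1.
  have -> : all (ltn^~ n.+1) (last b r :: s).
    by move: brs; rewrite lastI cat_rcons all_cat => /andP[].
  move=> /(_ isT).
  by rewrite -!(cat_rcons (last b r)) -lastI -(catA _ s).
apply: rt_trans (to_end _ _ _ mpq) _.
apply: rt_trans (word_equiv_sym (to_end _ _ _ mpq')).
exact: word_equiv_cat (IH _ _ pq pq' E).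
Qed.

(** * Words of permutations *)

Lemma one_line_perm n (s : 'S_n) : perm_eq (one_line s) (iota 1 n).
Proof.
have -> : iota 1 n = [seq (val i).+1 | i <- enum 'I_n].
  by rewrite (map_comp succn) val_enum_ord -(iotaDl 1).
have -> : one_line s = [seq (val i).+1 | i <- [seq s i | i <- enum 'I_n]].
  by rewrite -map_comp.
apply/perm_map/uniq_perm; rewrite ?enum_uniq //.
  by rewrite map_inj_uniq ?enum_uniq //; apply: perm_inj.
by move=> i; rewrite mem_enum -(permKV s i) map_f // mem_enum.
Qed.

Lemma nth_one_line n (s : 'S_n) (i : 'I_n) : nth 0 (one_line s) i = (s i).+1.
Proof. by rewrite (nth_map i) ?size_enum_ord // nth_ord_enum. Qed.

Lemma one_line_onto n (w : seq nat) : perm_eq w (iota 1 n) -> exists s : 'S_n, one_line s = w.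
Proof.
move=> wi; have sw : size w = n by rewrite (perm_size wi) size_iota.
have wn (i : 'I_n) : 0 < nth 0 w i <= n.
  have : nth 0 w i \in w by rewrite mem_nth // sw.
  by rewrite (perm_mem wi) mem_iota; lia.
have lt (i : 'I_n) : (nth 0 w i).-1 < n by have := wn i; lia.
have f_inj : injective (fun i => Ordinal (lt i)).
  move=> i j [] e; apply/val_inj/eqP.
  rewrite -(@nth_uniq _ 0 w) ?sw ?(perm_uniq wi) ?iota_uniq ?ltn_ord //.
  by have := wn i; have := wn j; move: e => /=; lia.
exists (perm f_inj); apply: (@eq_from_nth _ 0).
  by rewrite size_map size_enum_ord sw.
move=> i; rewrite size_map size_enum_ord => i_n.
rewrite (nth_one_line _ (Ordinal i_n)) permE /=.
by have := wn (Ordinal i_n); rewrite /=; lia.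
Qed.

Lemma one_line_inj n : injective (@one_line n).
Proof.
move=> s t e; apply/permP => i; apply/val_inj.
by have := nth_one_line s i; rewrite e nth_one_line => -[].
Qed.

(** * Replacement steps are exchanges *)

Lemma is_order_permE c u (s : 'S_c) : is_order_perm u s <->
  size u = c /\ forall i j, i < c -> j < c ->
    (nth 0 (one_line s) i < nth 0 (one_line s) j) = (nth 0 u i < nth 0 u j).
Proof.
split=> -[su h]; split=> //.
  move=> i j ic jc; rewrite (nth_one_line s (Ordinal ic)).
  by rewrite (nth_one_line s (Ordinal jc)) ltnS; apply: h.
by move=> i j; rewrite -h // !nth_one_line.
Qed.

(** Two distinct members of one part differ by the exchange of their last two
    letters, and their first letter is not 3. *)
Lemma K_part (B : {set 'S_3}) s t : B \in K_123_132_213_231 ->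
  s \in B -> t \in B -> s = t \/ exists x y z,
    [/\ one_line s = [:: x; y; z], one_line t = [:: x; z; y] & x < maxn y z].
Proof.
have inj := @one_line_inj 3.
rewrite !inE => /orP[/orP[]/eqP->|/imsetP[r _ ->]].
- rewrite !inE => /orP[]/eqP es /orP[]/eqP et;
    try (by left; apply: inj; rewrite es et); right.
    by exists 1, 2, 3.
  by exists 1, 3, 2.
- rewrite !inE => /orP[]/eqP es /orP[]/eqP et;
    try (by left; apply: inj; rewrite es et); right.
    by exists 2, 1, 3.
  by exists 2, 3, 1.
- by rewrite !inE => /eqP -> /eqP ->; left.
Qed.

(** A word of three letters whose order permutation is [s] is ordered like the
    one-line notation of [s]. *)
Lemma triple_pattern u x y z (s : 'S_3) : is_order_perm u s ->
  one_line s = [:: x; y; z] -> exists a b c,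
    [/\ u = [:: a; b; c], (x < y) = (a < b), (x < z) = (a < c)
      & (y < z) = (b < c)].
Proof.
move=> /is_order_permE[su h] es; rewrite es in h.
case: u su h => [|a [|b [|c [|? ?]]]] // _ h; exists a, b, c.
by split; [|exact: (h 0 1)|exact: (h 0 2)|exact: (h 1 2)].
Qed.

(** Three distinct letters are determined by their set and their relative
    order. *)
Lemma eq_triple a b c a' b' c' :
  uniq [:: a; b; c] -> perm_eq [:: a; b; c] [:: a'; b'; c'] ->
  (a < b) = (a' < b') -> (a < c) = (a' < c') -> (b < c) = (b' < c') ->
  [:: a; b; c] = [:: a'; b'; c'].
Proof.
move=> u p; have u' : uniq [:: a'; b'; c'] by rewrite -(perm_uniq p).
have := perm_mem p a; have := perm_mem p b; have := perm_mem p c.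
move: u u'; rewrite /= !inE !negb_or !andbT !eqxx ?orbT /= => u u' pc pb pa e1 e2 e3.
have [-> [-> ->]] : a = a' /\ b = b' /\ c = c' by lia.
by [].
Qed.

(** A replacement step may also leave the word unchanged, since the two order
    permutations need not be distinct. *)
Lemma replacement_step_word n (phi psi : 'S_n) :
  replacement_step K_123_132_213_231 phi psi ->
  one_line phi = one_line psi \/ word_step (one_line phi) (one_line psi).
Proof.
move=> [p [q [u [v [ephi epsi [s [t [us vt [B BK /andP[sB tB]]]]]]]]]].
have := one_line_perm phi; have := one_line_perm psi.
rewrite ephi epsi => pv pu.
have uuv : uniq u.
  have : uniq (p ++ u ++ q) by rewrite (perm_uniq pu) iota_uniq.
  by rewrite !cat_uniq => /and3P[_ _ /and3P[]].
have {pu pv} uv : perm_eq u v.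
  by rewrite -(perm_cat2r q) -(perm_cat2l p) (perm_trans pu) // perm_sym.
have us3 : uniq (one_line s) by rewrite (perm_uniq (one_line_perm s)) iota_uniq.
case: (K_part BK sB tB) => [est|[x [y [z [es et xyz]]]]].
  have : size (one_line s) = 3 by rewrite size_map size_enum_ord.
  case es : (one_line s) => [|x [|y [|z [|? ?]]]] // _; left.
  have [a [b [c [eu ab ac bc]]]] := triple_pattern us es.
  rewrite est in es; have [a' [b' [c' [ev ab' ac' bc']]]] := triple_pattern vt es.
  rewrite eu ev in uuv uv *; congr (_ ++ _ ++ _).
  by apply: eq_triple; rewrite -?ab -?ac -?bc.
have [a [b [c [eu ab ac bc]]]] := triple_pattern us es.
have [a' [b' [c' [ev ab' ac' bc']]]] := triple_pattern vt et.
right; exists p, q, a, b, c; rewrite eu ev in uuv uv *.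
have sw : perm_eq [:: a; c; b] [:: a; b; c].
  by rewrite perm_cons (perm_catC [:: c] [:: b]).
rewrite es in us3; have := us3; have := uuv.
rewrite /= !inE !negb_or !andbT => uabc uxyz; split=> //; last by lia.
(* The triple a c b has the order permutation of v, and the same letters. *)
suff [-> -> ->] : [:: a'; b'; c'] = [:: a; c; b] by [].
apply/esym/eq_triple.
- by rewrite (perm_uniq sw).
- exact: perm_trans sw uv.
- by rewrite -ac -ab'.
- by rewrite -ab -ac'.
- by rewrite -bc'; lia.
Qed.

Lemma word_step_replacement n (phi psi : 'S_n) :
  word_step (one_line phi) (one_line psi) ->
  replacement_step K_123_132_213_231 phi psi.
Proof.
move=> [p [q [a [b [c [ephi epsi h]]]]]].
exists p, q, [:: a; b; c], [:: a; c; b]; split=> //.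
have : uniq [:: a; b; c].
  have : uniq (one_line phi) by rewrite (perm_uniq (one_line_perm phi)) iota_uniq.
  by rewrite ephi !cat_uniq => /and3P[_ _ /and3P[]].
rewrite /= !inE !negb_or andbT => /andP[/andP[ab ac] bc].
have pat x y z (s : 'S_3) u v w : one_line s = [:: x; y; z] ->
    (x < y) = (u < v) -> (x < z) = (u < w) -> (y < z) = (v < w) ->
    (y < x) = (v < u) -> (z < x) = (w < u) -> (z < y) = (w < v) ->
    is_order_perm [:: u; v; w] s.
  move=> es *; apply/is_order_permE; split=> //; rewrite es.
  by case=> [|[|[|i]]] [|[|[|j]]] //= _ _; rewrite !ltnn.
have exchange x y z P : perms_of_words 3 P \in K_123_132_213_231 ->
    ([:: x; y; z] \in P) && ([:: x; z; y] \in P) ->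
    perm_eq [:: x; y; z] (iota 1 3) ->
    (x < y) = (a < b) -> (x < z) = (a < c) -> (y < z) = (b < c) ->
    exists s t : 'S_3, [/\ is_order_perm [:: a; b; c] s,
      is_order_perm [:: a; c; b] t
      & exists2 B : {set 'S_3}, B \in K_123_132_213_231 & (s \in B) && (t \in B)].
  move=> PK xyzP xyzi h1 h2 h3.
  have [s es] := one_line_onto xyzi.
  have [|t et] := @one_line_onto 3 [:: x; z; y].
    by apply: perm_trans xyzi; rewrite perm_cons (perm_catC [:: z] [:: y]).
  have : uniq [:: x; y; z] by rewrite (perm_uniq xyzi).
  rewrite /= !inE !negb_or andbT => /andP[/andP[xy xz] yz].
  exists s, t; split; [apply: pat es _ _ _ _ _ _; lia|
    apply: pat et _ _ _ _ _ _; lia|].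
  by exists (perms_of_words 3 P) => //; rewrite 2!inE es et.
have K1 : perms_of_words 3 [:: [:: 1; 2; 3]; [:: 1; 3; 2]] \in K_123_132_213_231.
  by rewrite !inE eqxx.
have K2 : perms_of_words 3 [:: [:: 2; 1; 3]; [:: 2; 3; 1]] \in K_123_132_213_231.
  by rewrite !inE eqxx orbT.
(* The part is decided by whether a is the smallest or the middle letter. *)
case: (ltnP b c) => bc'; case: (ltnP a (minn b c)) => am.
- by apply: (exchange 1 2 3 _ K1); rewrite //=; lia.
- by apply: (exchange 2 1 3 _ K2); rewrite //=; lia.
- by apply: (exchange 1 3 2 _ K1); rewrite //=; lia.
- by apply: (exchange 2 3 1 _ K2); rewrite //=; lia.
Qed.

Lemma word_equiv_replacement n (phi : 'S_n) w :
  word_equiv (one_line phi) w ->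
  exists2 psi : 'S_n, one_line psi = w
    & replacement_equiv K_123_132_213_231 phi psi.
Proof.
move e: (one_line phi) => v vw.
elim: vw phi e => [x y xy|x|x y z _ IH1 _ IH2] phi e.
- have [|psi epsi] := @one_line_onto n y.
    by apply: perm_trans (one_line_perm phi); rewrite e perm_sym word_step_perm.
  exists psi => //; apply/rst_step/word_step_replacement.
  by rewrite e epsi.
- by exists phi; last exact: rst_refl.
- have [psi e1 r1] := IH1 _ e; have [chi e2 r2] := IH2 _ e1.
  by exists chi; last exact: rst_trans r1 r2.
Qed.

Lemma replacement_equivE n (phi psi : 'S_n) :
  replacement_equiv K_123_132_213_231 phi psi <->
  lrmin (one_line phi) = lrmin (one_line psi).
Proof.
split=> [|E].
  elim=> [x y /replacement_step_word[->//|]|//|x y _ ->//|x y z _ -> _ ->//].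
  exact: word_step_lrmin.
have W := word_equiv_lrmin (one_line_perm phi) (one_line_perm psi) E.
by have [chi /one_line_inj <-] := word_equiv_replacement W.
Qed.

(** * Counting *)

(** The left-to-right minima other than 1, where i : 'I_m stands for the letter
    i + 2. *)
Definition lrmin_set m (s : 'S_m.+1) : {set 'I_m} :=
  [set i : 'I_m | i.+2 \in lrmin (one_line s)].

(** The set loses no information, as [lrmin] lists its letters in decreasing
    order and 1 is always among them. *)
Lemma lrmin_set_eq m (s t : 'S_m.+1) :
  lrmin_set s = lrmin_set t -> lrmin (one_line s) = lrmin (one_line t).
Proof.
move=> E; apply: (irr_sorted_eq (leT := gtn)); try exact: lrmin_sorted.
- by move=> y x z /=; lia.
- by move=> x /=; rewrite ltnn.
have range (r : 'S_m.+1) x : x \in lrmin (one_line r) -> 0 < x < m.+2.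
  by move/lrmin_subset; rewrite (perm_mem (one_line_perm r)) mem_iota.
have one (r : 'S_m.+1) : 1 \in lrmin (one_line r).
  apply: mem_lrmin_min; first by rewrite (perm_mem (one_line_perm r)) mem_iota.
  by apply/allP => x; rewrite (perm_mem (one_line_perm r)) mem_iota => /andP[].
case=> [|[|x]]; first by apply/idP/idP => /range.
  by rewrite !one.
have [xm|mx] := ltnP x m; last by apply/idP/idP => /range; lia.
by have /setP/(_ (Ordinal xm)) := E; rewrite !inE.
Qed.

(** Inserting the letter m + 2 into a word on 1, ..., m + 1 makes it a minimum
    when put in front, and changes no minimum when put at the end. *)
Lemma word_with_lrmin (P : pred nat) m : exists2 w,
  perm_eq w (iota 1 m.+1) & forall i, (i.+2 \in lrmin w) = (i < m) && P i.
Proof.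
elim: m => [|m [w wi Hw]]; first by exists [:: 1].
have wm : all (ltn^~ m.+2) w.
  by apply/allP => x; rewrite (perm_mem wi) mem_iota => /andP[].
exists (if P m then m.+2 :: w else rcons w m.+2).
  rewrite iota1_rcons; case: ifP => _; last by rewrite -!cats1 perm_cat2r.
  by rewrite perm_sym perm_rcons perm_cons perm_sym.
move=> i; case: ifP => Pm.
  rewrite (@lrmin_max [::] w) // inE Hw !eqSS [i < m.+1]ltnS [i <= m]leq_eqVlt.
  by case: eqP => // ->; rewrite Pm.
rewrite -cats1 lrmin_max ?cats0 //.
case: w wi Hw {wm} => [/perm_size//|x w] _ ->.
by rewrite [i < m.+1]ltnS [i <= m]leq_eqVlt; case: eqP => // ->; rewrite Pm ltnn.
Qed.

Lemma lrmin_set_onto m (A : {set 'I_m}) : exists s : 'S_m.+1, lrmin_set s = A.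
Proof.
have [w wi Hw] := word_with_lrmin (fun i => i \in [seq val j | j in A]) m.
have [s es] := one_line_onto wi.
exists s; apply/setP => i; rewrite inE es Hw ltn_ord /=.
by rewrite mem_image //; apply: val_inj.
Qed.

Theorem proposition3p84 (n : nat) (hn : 1 <= n) :
  #|replacement_classes K_123_132_213_231 n| = 2 ^ (n - 1).
Proof.
case: n hn => [//|m] _; rewrite subn1 /=.
(* The classes are the fibers of [lrmin_set], which is onto. *)
pose fiber (A : {set 'I_m}) := [set psi : 'S_m.+1 | lrmin_set psi == A].
have fiber_inj : injective fiber.
  move=> A B; have [s <-] := lrmin_set_onto A => /setP/(_ s).
  by rewrite !inE eqxx => /esym/eqP.
have -> : replacement_classes K_123_132_213_231 m.+1 = fiber @: setT.
  have classE (phi : 'S_m.+1) :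
      [set psi | `[< replacement_equiv K_123_132_213_231 phi psi >]]
      = fiber (lrmin_set phi).
    apply/setP => psi; rewrite !inE; apply/asboolP/eqP => [/replacement_equivE E|E].
      by rewrite /lrmin_set E.
    exact/replacement_equivE/esym/lrmin_set_eq.
  apply/setP => C; apply/imsetP/imsetP => -[].
    by move=> phi _ ->; exists (lrmin_set phi); rewrite ?inE.
  by move=> A _ ->; have [s <-] := lrmin_set_onto A; exists s.
by rewrite card_imset // -powersetT card_powerset cardsT card_ord.
Qed.
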